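(* Let $f_1,\dots,f_N:\mathbb{R}^d\to\mathbb{R}$ be convex, coercive, differentiable functions whose gradients are Lipschitz continuous with constant $L$. Consider the problem $$\min_{x_1,\dots,x_N\in\mathbb{R}^d}\ \frac1N\sum_{i=1}^N f_i(x_i)+\lambda\sum_{j\ne i}\|x_i-x_j\|. \qquad (\mathrm{P})$$ For a partition $C_1,\dots,C_K$ of $[N]=\{1,\dots,N\}$ into nonempty sets with $n_k=|C_k|$, and for a parameter $\lambda>0$, let $(w_1^\star,\dots,w_K^\star)$, $w_k^\star=w_k^\star(\lambda)$, be a solution (minimizer) of the clustered problem $$\min_{w_1,\dots,w_K\in\mathbb{R}^d}\ \frac1N\sum_{k=1}^K n_k\,g_k(w_k)+\lambda\sum_{l\ne k} n_kn_l\,\|w_k-w_l\|,\qquad g_k(w)=\frac1{n_k}\sum_{i\in C_k}f_i(w).$$ Assume that, for this partition and this $\lambda$, $$\lambda\ \ge\ \max_{k=1,\dots,K}\ \max_{i,j\in C_k}\frac{\|\nabla f_i(w_k^\star)-\nabla f_j(w_k^\star)\|}{n_k}.$$ Define $x_i^\star=w_k^\star$ for each $i\in C_k$, $k=1,\dots,K$. Then $(x_1^\star,\dots,x_N^\star)$ is a solution (minimizer) of (P) with the same $\lambda$.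
   Context: $\|\cdot\|$ is the Euclidean norm on $\mathbb{R}^d$. The sum over $j\ne i$ runs over all ordered pairs $(i,j)$ with $i,j\in\{1,\dots,N\}$, $i\neq j$ ($N(N-1)$ terms), and the sum over $l\ne k$ likewise runs over all ordered pairs $(k,l)$ with $k,l\in\{1,\dots,K\}$, $k\ne l$. A function $f:\mathbb{R}^d\to\mathbb{R}$ is coercive if $f(x)\to+\infty$ whenever $\|x\|\to+\infty$. Lipschitz gradients with constant $L$ means $\|\nabla f_i(x)-\nabla f_i(y)\|\le L\|x-y\|$ for all $x,y\in\mathbb{R}^d$ and all $i$. *)

(* Defs.v *)
From mathcomp Require Import all_boot all_order all_algebra.
From mathcomp Require Import all_classical all_reals all_analysis.

Set Implicit Arguments.
Unset Strict Implicit.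
Unset Printing Implicit Defensive.

Import Order.TTheory GRing.Theory Num.Theory.
Import numFieldNormedType.Exports.

Local Open Scope classical_set_scope.
Local Open Scope ring_scope.

(* The library's norm `|x| on 'rV[R]_d is the sup norm, hence this definition. *)
Definition enorm (R : realType) (d : nat) (x : 'rV[R]_d) : R :=
  Num.sqrt (\sum_(j < d) x ord0 j ^+ 2).

Definition gradient (R : realType) (d : nat) (f : 'rV[R]_d -> R)
    (x : 'rV[R]_d) : 'rV[R]_d :=
  \row_(j < d) 'D_(delta_mx ord0 j) f x.

Definition coercive (R : realType) (d : nat) (f : 'rV[R]_d -> R) : Prop :=
  forall M : R, exists r : R, forall x : 'rV[R]_d, r <= enorm x -> M <= f x.

Definition gradient_lipschitz (R : realType) (d : nat) (L : R)
    (f : 'rV[R]_d -> R) : Prop :=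
  forall x y : 'rV[R]_d,
    enorm (gradient f x - gradient f y) <= L * enorm (x - y).

Definition minimizer (R : realType) (T : Type) (F : T -> R) (x : T) : Prop :=
  forall y : T, F x <= F y.

(* Ordered pairs: every unordered pair {i, j} is counted twice. *)
Definition full_objective (R : realType) (d N : nat)
    (f : 'I_N -> 'rV[R]_d -> R) (lambda : R) (x : 'I_N -> 'rV[R]_d) : R :=
  N%:R^-1 * (\sum_(i < N) f i (x i))
  + lambda * (\sum_(i < N) \sum_(j < N | j != i) enorm (x i - x j)).

Definition cluster_avg (R : realType) (d N K : nat)
    (f : 'I_N -> 'rV[R]_d -> R) (C : 'I_K -> {set 'I_N}) (k : 'I_K)
    (w : 'rV[R]_d) : R :=
  #|C k|%:R^-1 * (\sum_(i in C k) f i w).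

Definition clustered_objective (R : realType) (d N K : nat)
    (f : 'I_N -> 'rV[R]_d -> R) (C : 'I_K -> {set 'I_N}) (lambda : R)
    (w : 'I_K -> 'rV[R]_d) : R :=
  N%:R^-1 * (\sum_(k < K) #|C k|%:R * cluster_avg f C k (w k))
  + lambda * (\sum_(k < K) \sum_(l < K | l != k)
                #|C k|%:R * #|C l|%:R * enorm (w k - w l)).

(* The default value 0 of the maxima is harmless: the terms are nonnegative. *)
Definition recovery_threshold (R : realType) (d N K : nat)
    (f : 'I_N -> 'rV[R]_d -> R) (C : 'I_K -> {set 'I_N})
    (w : 'I_K -> 'rV[R]_d) : R :=
  \big[Num.max/0]_(k < K) \big[Num.max/0]_(i in C k) \big[Num.max/0]_(j in C k)
    (enorm (gradient (f i) (w k) - gradient (f j) (w k)) / #|C k|%:R).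

(* Main.v *)
(* Given a competitor [y], replace every [y i] by the mean [h] of [y] over the
   cluster of [i]. By the triangle inequality the inter-cluster part of the
   penalty does not increase, and [h] is then admissible in the clustered
   problem, whose first-order optimality condition along [h - w] bounds the
   linearised loss plus penalty from below. What remains is the intra-cluster
   linear term in [y - h]: since [y - h] sums to zero on each cluster, only
   differences of gradients matter, and the intra-cluster penalty dominates
   them by Cauchy-Schwarz and the lower bound on [lambda]. *)
Require Import Defs.
From mathcomp Require Import all_boot all_order all_algebra.
From mathcomp Require Import all_classical all_reals all_analysis.
From mathcomp Require Import ring lra.

Set Implicit Arguments.
Unset Strict Implicit.
Unset Printing Implicit Defensive.

Import Order.TTheory GRing.Theory Num.Theory.
Import numFieldNormedType.Exports.

Local Open Scope classical_set_scope.
Local Open Scope ring_scope.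

(** * Euclidean inner product and norm *)

Definition dot {R : realType} {d : nat} (u v : 'rV[R]_d) : R :=
  \sum_(j < d) u ord0 j * v ord0 j.

Lemma dotC (R : realType) (d : nat) (u v : 'rV[R]_d) : dot u v = dot v u.
Proof. by apply: eq_bigr => j _; rewrite mulrC. Qed.

Lemma dotDr (R : realType) (d : nat) (u v w : 'rV[R]_d) :
  dot u (v + w) = dot u v + dot u w.
Proof. by rewrite -big_split; apply: eq_bigr => j _; rewrite mxE mulrDr. Qed.

Lemma dotNr (R : realType) (d : nat) (u v : 'rV[R]_d) : dot u (- v) = - dot u v.
Proof.
by rewrite /dot -sumrN; apply: eq_bigr => j _; rewrite mxE mulrN.
Qed.

Lemma dotBr (R : realType) (d : nat) (u v w : 'rV[R]_d) :
  dot u (v - w) = dot u v - dot u w.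
Proof. by rewrite dotDr dotNr. Qed.

Lemma dotBl (R : realType) (d : nat) (u v w : 'rV[R]_d) :
  dot (v - w) u = dot v u - dot w u.
Proof. by rewrite dotC dotBr !(dotC u). Qed.

Lemma dot0r (R : realType) (d : nat) (u : 'rV[R]_d) : dot u 0 = 0.
Proof. by rewrite -(subrr 0) dotBr subrr. Qed.

Lemma dot_sumr (R : realType) (d : nat) (I : finType) (P : pred I)
    (u : 'rV[R]_d) (v : I -> 'rV[R]_d) :
  dot u (\sum_(i | P i) v i) = \sum_(i | P i) dot u (v i).
Proof.
by rewrite exchange_big; apply: eq_bigr => j _; rewrite summxE mulr_sumr.
Qed.

Lemma dot_suml (R : realType) (d : nat) (I : finType) (P : pred I)
    (u : 'rV[R]_d) (v : I -> 'rV[R]_d) :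
  dot (\sum_(i | P i) v i) u = \sum_(i | P i) dot (v i) u.
Proof. by rewrite dotC dot_sumr; apply: eq_bigr => i _; rewrite dotC. Qed.

Lemma enorm_ge0 (R : realType) (d : nat) (u : 'rV[R]_d) : 0 <= enorm u.
Proof. exact: sqrtr_ge0. Qed.

Lemma sqr_enorm (R : realType) (d : nat) (u : 'rV[R]_d) :
  enorm u ^+ 2 = dot u u.
Proof.
rewrite sqr_sqrtr; first by apply: eq_bigr => j _; rewrite expr2.
by apply: sumr_ge0 => j _; exact: sqr_ge0.
Qed.

Lemma enorm0 (R : realType) (d : nat) : enorm (0 : 'rV[R]_d) = 0.
Proof.
by rewrite /enorm big1 ?sqrtr0// => j _; rewrite mxE expr0n.
Qed.

Lemma enorm0_eq0 (R : realType) (d : nat) (u : 'rV[R]_d) : enorm u = 0 -> u = 0.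
Proof.
move=> u0; have /eqP : \sum_(j < d) u ord0 j ^+ 2 = 0.
  under eq_bigr do rewrite expr2.
  by have := sqr_enorm u; rewrite u0 expr0n => /esym.
rewrite psumr_eq0 => [/allP u2|j _]; last exact: sqr_ge0.
apply/rowP => j; rewrite mxE; apply/eqP; rewrite -sqrf_eq0.
by apply: u2; rewrite mem_index_enum.
Qed.

Lemma enormZ (R : realType) (d : nat) (a : R) (u : 'rV[R]_d) :
  enorm (a *: u) = `|a| * enorm u.
Proof.
rewrite /enorm -sqrtr_sqr -sqrtrM ?sqr_ge0// mulr_sumr.
by under eq_bigr do rewrite mxE exprMn.
Qed.

Lemma enormN (R : realType) (d : nat) (u : 'rV[R]_d) : enorm (- u) = enorm u.
Proof. by rewrite -scaleN1r enormZ normrN1 mul1r. Qed.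

(** Cauchy-Schwarz: with [a = enorm u] and [b = enorm v], the squared norm of [b *: u - a *: v]
    equals [2 * a * b * (a * b - dot u v)], and [a * b] may be divided out once zero vectors are set
    aside. *)
Lemma dot_le_enorm (R : realType) (d : nat) (u v : 'rV[R]_d) :
  dot u v <= enorm u * enorm v.
Proof.
have [/enorm0_eq0 ->|u0] := eqVneq (enorm u) 0.
  by rewrite enorm0 mul0r dotC dot0r.
have [/enorm0_eq0 ->|v0] := eqVneq (enorm v) 0.
  by rewrite enorm0 mulr0 dot0r.
have a0 : 0 < enorm u by rewrite lt_neqAle eq_sym u0 enorm_ge0.
have b0 : 0 < enorm v by rewrite lt_neqAle eq_sym v0 enorm_ge0.
set a := enorm u in a0 *; set b := enorm v in b0 *.
have : 0 <= \sum_(j < d) (b * u ord0 j - a * v ord0 j) ^+ 2.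
  by apply: sumr_ge0 => j _; exact: sqr_ge0.
have -> : \sum_(j < d) (b * u ord0 j - a * v ord0 j) ^+ 2 =
    b ^+ 2 * dot u u - 2 * (a * b) * dot u v + a ^+ 2 * dot v v.
  rewrite /dot !mulr_sumr -sumrB -big_split; apply: eq_bigr => j _ /=; ring.
rewrite -!sqr_enorm -/a -/b => h.
rewrite -subr_ge0 -(pmulr_rge0 _ (mulr_gt0 a0 b0)); nra.
Qed.

Lemma ler_enormD (R : realType) (d : nat) (u v : 'rV[R]_d) :
  enorm (u + v) <= enorm u + enorm v.
Proof.
rewrite -ler_sqr ?nnegrE ?addr_ge0 ?enorm_ge0//.
have := dot_le_enorm u v.
by rewrite sqrrD !sqr_enorm dotDr ![dot (_ + _) _]dotC !dotDr (dotC v u); lra.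
Qed.

Lemma ler_enorm_sum (R : realType) (d : nat) (I : finType) (P : pred I)
    (u : I -> 'rV[R]_d) :
  enorm (\sum_(i | P i) u i) <= \sum_(i | P i) enorm (u i).
Proof.
elim/big_ind2: _ => [|a r b s ha hb|//]; first by rewrite enorm0.
exact: le_trans (ler_enormD _ _) (lerD ha hb).
Qed.

(** * Gradients, convexity and first-order conditions *)

Lemma derive_gradient (R : realType) (d : nat) (f : 'rV[R]_d -> R)
    (x v : 'rV[R]_d) :
  differentiable f x -> 'D_v f x = dot (gradient f x) v.
Proof.
move=> df; rewrite deriveE// [in LHS](row_sum_delta v) linear_sum.
by apply: eq_bigr => j _; rewrite linearZ /= mxE deriveE// mulrC.
Qed.

Lemma cvg_gradient (R : realType) (d : nat) (f : 'rV[R]_d -> R)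
    (x v : 'rV[R]_d) : differentiable f x ->
  t^-1 * (f (x + t *: v) - f x) @[t --> 0^'+] --> dot (gradient f x) v.
Proof.
move=> df; rewrite -derive_gradient//.
have /cvg_dnbhs_at_right := diff_derivable df (v := v).
set q := (X in X @ _ --> _) => cq.
by rewrite (_ : (fun t => _) = q)//; apply/funext => t; rewrite /q /= (addrC x).
Qed.

(** By convexity the difference quotient at [x] towards [y] is at most [f y - f x] for all [t] in
    (0, 1]; the bound survives the limit from the right. *)
Lemma convex_gradient (R : realType) (d : nat) (f : 'rV[R]_d -> R)
    (x y : 'rV[R]_d) :
  convex_function [set: 'rV[R]_d] f -> differentiable f x ->
  f x + dot (gradient f x) (y - x) <= f y.
Proof.
move=> cf df; rewrite addrC -lerBrDr.
have cv := cvg_gradient (v := y - x) df.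
apply: (cvgr_to_le cv); near=> t.
have t0 : 0 < t by [].
have t1 : t <= 1 by near: t; exact: nbhs_right_le.
(* [conv] puts the weight [t] on its first point, so [y] comes first to obtain
   [x + t *: (y - x)]. *)
have := cf (Itv01 (ltW t0) t1) y x (mem_set I) (mem_set I).
rewrite convRE /= /unstable.onem ler_pdivrMl//.
rewrite [conv _ _ _](_ : _ = x + t *: (y - x)); first by lra.
by rewrite /conv/= scalerBr scalerBl scale1r addrCA.
Unshelve. all: by end_near. Qed.

(** Divide by [t] and let it tend to 0 from the right. The slope [a] makes room for a
    nondifferentiable penalty, whose increment is only bounded linearly in [t]. *)
Lemma sum_gradient_ge (R : realType) (d : nat) (I : finType)
    (f : I -> 'rV[R]_d -> R) (x v : I -> 'rV[R]_d) (a : R) :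
  (forall i, differentiable (f i) (x i)) ->
  (forall t, 0 < t -> t <= 1 ->
    a * t <= \sum_i (f i (x i + t *: v i) - f i (x i))) ->
  a <= \sum_i dot (gradient (f i) (x i)) (v i).
Proof.
move=> df h.
have cv : \sum_i t^-1 * (f i (x i + t *: v i) - f i (x i)) @[t --> 0^'+] -->
    \sum_i dot (gradient (f i) (x i)) (v i).
  apply: cvg_big => [|i _]; first exact: add_continuous.
  exact: cvg_gradient.
apply: (cvgr_to_ge cv); near=> t.
have t0 : 0 < t by [].
have t1 : t <= 1 by near: t; exact: nbhs_right_le.
by rewrite -mulr_sumr ler_pdivlMl// mulrC h.
Unshelve. all: by end_near. Qed.

(** * Pairwise sums over the fibers of a labelling *)

Lemma sumr_const_fiber (V : nmodType) (I J : finType) (p : I -> J) (k : J)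
    (c : V) : \sum_(i | p i == k) c = c *+ #|[set i | p i == k]%SET|.
Proof. by rewrite -sumr_const; apply: eq_bigl => i; rewrite inE. Qed.

(** For two distinct fibers, the differences [y i - y j] add up to [n k * n l] times [h k - h l], so
    the triangle inequality applies; within a single fiber the term in [h] vanishes and equality
    holds. Writing the mean [h k] without division also covers empty fibers. *)
Lemma sum_enorm_fibers (R : realType) (d : nat) (I J : finType) (p : I -> J)
    (y : I -> 'rV[R]_d) (h : J -> 'rV[R]_d) :
  (forall k, \sum_(i | p i == k) y i = #|[set i | p i == k]%SET|%:R *: h k) ->
  \sum_i \sum_j enorm (h (p i) - h (p j)) +
    \sum_i \sum_(j | p j == p i) enorm (y i - y j) <=
  \sum_i \sum_j enorm (y i - y j).
Proof.
move=> hy; rewrite -big_split/=.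
under eq_bigr do rewrite [X in _ + X]big_mkcond -big_split/=.
have fibers (F : I -> I -> R) : \sum_i \sum_j F i j =
    \sum_k \sum_l \sum_(i | p i == k) \sum_(j | p j == l) F i j.
  rewrite (partition_big p xpredT)//; apply: eq_bigr => k _.
  rewrite [RHS]exchange_big/=; apply: eq_bigr => i _.
  by rewrite (partition_big p xpredT).
rewrite !fibers; apply: ler_sum => k _; apply: ler_sum => l _.
have [<-|kl] := eqVneq k l.
  apply: ler_sum => i /eqP ik; apply: ler_sum => j /eqP jk.
  by rewrite ik jk eqxx subrr enorm0 add0r.
rewrite [leLHS](_ : _ =
    enorm (\sum_(i | p i == k) \sum_(j | p j == l) (y i - y j))).
  apply: le_trans (ler_enorm_sum _ _) _; apply: ler_sum => i _.
  exact: ler_enorm_sum.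
pose n k : R := #|[set i | p i == k]%SET|%:R.
have sumc k' (V : lmodType R) (c : V) : \sum_(i | p i == k') c = n k' *: c.
  by rewrite sumr_const_fiber scaler_nat.
transitivity (enorm ((n k * n l) *: (h k - h l))).
  rewrite enormZ ger0_norm ?mulr_ge0// -mulrA.
  (* Reals are viewed as vectors over themselves, so that [sumc] collapses these constant sums
     too. *)
  rewrite -[RHS]/(n k *: (n l *: (enorm (h k - h l) : R^o))) -!sumc.
  apply: eq_bigr => i /eqP ->; apply: eq_bigr => j /eqP ->.
  by rewrite eq_sym (negPf kl) addr0.
congr enorm; under eq_bigr do rewrite sumrB sumc hy.
by rewrite sumrB sumc -scaler_sumr hy !scalerA scalerBr (mulrC (n l)).
Qed.

(* Since the [r i] sum to zero, the sum over pairs of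
   [dot (g i - g j) (r i - r j)] is [2 * #|A|] times the sum of
   [dot (g i) (r i)]. *)
Lemma sum_dot_centered_ge (R : realType) (d : nat) (I : finType) (A : {set I})
    (g r : I -> 'rV[R]_d) (c : R) :
  \sum_(i in A) r i = 0 ->
  (forall i j, i \in A -> j \in A -> enorm (g i - g j) <= c * #|A|%:R) ->
  - (c * \sum_(i in A) \sum_(j in A) enorm (r i - r j)) <=
  2 * \sum_(i in A) dot (g i) (r i).
Proof.
move=> r0 gc; have [->|A0] := eqVneq A finset.set0.
  by rewrite !big_set0 !mulr0 oppr0.
have n0 : 0 < #|A|%:R :> R by rewrite ltr0n card_gt0.
rewrite -(ler_pM2l n0) mulrN lerNl.
have -> : - (#|A|%:R * (2 * \sum_(i in A) dot (g i) (r i))) =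
    \sum_(i in A) \sum_(j in A) dot (g i - g j) (- (r i - r j)).
  (* For fixed [i], the terms [dot (g i) (r j)] cancel in the sum over [j]; the term in
     [\sum_(j in A) g j] cancels later, in the sum over [i]. *)
  transitivity (- \sum_(i in A) (#|A|%:R * dot (g i) (r i) +
      \sum_(j in A) dot (g j) (r j) - dot (\sum_(j in A) g j) (r i))).
    rewrite sumrB big_split/= -mulr_sumr sumr_const -mulr_natl.
    by rewrite -dot_sumr r0 dot0r; ring.
  rewrite -sumrN; apply: eq_bigr => i _.
  under [RHS]eq_bigr do rewrite dotNr dotBl !dotBr.
  rewrite sumrN !sumrB -(dot_sumr _ (g i) r) r0 dot0r sumr_const -mulr_natl.
  by rewrite dot_suml; ring.
rewrite mulrA (mulrC _ c) mulr_sumr; apply: ler_sum => i iA.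
rewrite mulr_sumr; apply: ler_sum => j jA.
apply: le_trans (dot_le_enorm _ _) _.
by rewrite enormN ler_wpM2r ?enorm_ge0// gc.
Qed.

(** * The two objectives in terms of a labelling *)

Lemma full_objectiveE (R : realType) (d N : nat) (f : 'I_N -> 'rV[R]_d -> R)
    (lambda : R) (x : 'I_N -> 'rV[R]_d) :
  full_objective f lambda x =
  N%:R^-1 * (\sum_(i < N) f i (x i)) +
  lambda * (\sum_(i < N) \sum_(j < N) enorm (x i - x j)).
Proof.
congr (_ + _ * _); apply: eq_bigr => i _.
by rewrite [RHS](bigD1 i)//= subrr enorm0 add0r.
Qed.

(** The cardinality weights count the indices and the pairs of indices carrying given labels. Hence
    the clustered problem is (P) restricted to points constant on clusters. *)
Lemma clustered_objectiveE (R : realType) (d N K : nat)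
    (f : 'I_N -> 'rV[R]_d -> R) (C : 'I_K -> {set 'I_N}) (p : 'I_N -> 'I_K)
    (lambda : R) (u : 'I_K -> 'rV[R]_d) :
  (forall k, C k = [set i | p i == k]%SET) ->
  clustered_objective f C lambda u = full_objective f lambda (u \o p).
Proof.
move=> Cp; rewrite full_objectiveE /=.
congr (_ * _ + _ * _).
  rewrite [RHS](partition_big p xpredT)//; apply: eq_bigr => k _.
  (* On an empty class the weight 0 matches the empty sum; elsewhere it cancels the inverse in the
     average. *)
  rewrite /cluster_avg; have [C0|C0] := eqVneq #|C k| 0%N.
    rewrite C0 mul0r big1// => i ik.
    by have : i \in C k by [rewrite Cp inE]; rewrite (cards0_eq C0) inE.
  rewrite mulVKf ?pnatr_eq0// Cp; apply: eq_big => i; first by rewrite inE.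
  by rewrite inE => /eqP ->.
rewrite [RHS](partition_big p xpredT)//; apply: eq_bigr => k _.
rewrite [RHS](eq_bigr (fun=> \sum_l #|C l|%:R * enorm (u k - u l))).
  rewrite sumr_const_fiber -[RHS]mulr_natl -Cp [in RHS](bigD1 k)//= subrr.
  rewrite enorm0 mulr0 add0r mulr_sumr.
  by apply: eq_bigr => l _; rewrite mulrA.
move=> i /eqP ->; rewrite (partition_big p xpredT)//; apply: eq_bigr => l _.
rewrite (eq_bigr (fun=> enorm (u k - u l))) => [|j /eqP -> //].
by rewrite sumr_const_fiber -[LHS]mulr_natl Cp.
Qed.

(** Covering provides a label for every index, and disjointness makes it unique. Sums can then be
    regrouped by label. *)
Lemma partition_fibers (N K : nat) (C : 'I_K -> {set 'I_N}) :
  classical_sets.partition [set: 'I_K] (fun k => [set` C k]) [set: 'I_N] ->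
  exists p : 'I_N -> 'I_K, forall k, C k = [set i | p i == k]%SET.
Proof.
move=> [cov triv _].
have /choice[p pC] : forall i, exists k, i \in C k.
  move=> i; have : [set: 'I_N] i by [].
  by rewrite -cov => -[k _ ik]; exists k.
exists p => k; apply/setP => i; rewrite inE; apply/idP/eqP => [ik|<-//].
by apply: triv => //; exists i; split; [exact: pC|exact: ik].
Qed.

(** * Optimality of the clustered solution in (P) *)

Theorem theorem1 (R : realType) (d N K : nat) (L lambda : R)
    (f : 'I_N -> 'rV[R]_d -> R) (C : 'I_K -> {set 'I_N})
    (w : 'I_K -> 'rV[R]_d) (x : 'I_N -> 'rV[R]_d)
    (f_convex : forall i : 'I_N, convex_function [set: 'rV[R]_d] (f i))
    (f_coercive : forall i : 'I_N, coercive (f i))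
    (f_diff : forall (i : 'I_N) (y : 'rV[R]_d), differentiable (f i) y)
    (f_lipschitz : forall i : 'I_N, gradient_lipschitz L (f i))
    (C_partition :
      classical_sets.partition [set: 'I_K] (fun k => [set` C k]) [set: 'I_N])
    (lambda_gt0 : 0 < lambda)
    (w_min : minimizer (clustered_objective f C lambda) w)
    (lambda_ge : lambda >= recovery_threshold f C w)
    (x_def : forall (k : 'I_K) (i : 'I_N), i \in C k -> x i = w k) :
  minimizer (full_objective f lambda) x.
Proof.
have [p Cp] := partition_fibers C_partition.
have pC i : i \in C (p i) by rewrite Cp inE.
have xE i : x i = w (p i) by exact: x_def.
move=> y; case: (posnP N) => [N0|N0].
  (* With no indices there is only one point; afterwards [N%:R^-1] can be cleared. *)
  by rewrite (_ : y = x)//; apply/funext => i;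
    have := leq_ltn_trans (leq0n i) (ltn_ord i); rewrite N0.
have nC k : #|C k|%:R != 0 :> R.
  have [_ _ /(_ k I)[i ik]] := C_partition.
  by rewrite pnatr_eq0 -lt0n; apply/card_gt0P; exists i.
pose h k : 'rV[R]_d := #|C k|%:R^-1 *: \sum_(i in C k) y i.
have hy k : \sum_(i in C k) y i = #|C k|%:R *: h k.
  by rewrite scalerA divff// scale1r.
pose P (z : 'I_N -> 'rV[R]_d) := \sum_i \sum_j enorm (z i - z j).
pose Q := \sum_i \sum_(j | p j == p i) enorm (y i - y j).
pose g i := gradient (f i) (x i).
pose b : R := N%:R.
have b1 : 1 <= b by rewrite ler1n.
have b0 : 0 < b by lra.
(* Convexity of the penalty on the segment from [x] to [h \o p] bounds its increment linearly in
   [t]. *)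
have Pconv t : 0 < t -> t <= 1 ->
    P (fun i => x i + t *: (h (p i) - x i)) <= P x + t * (P (h \o p) - P x).
  move=> t0 t1.
  rewrite [leRHS](_ : _ = (1 - t) * P x + t * P (h \o p)); last by ring.
  rewrite /P !mulr_sumr -big_split; apply: ler_sum => i _ /=.
  rewrite !mulr_sumr -big_split; apply: ler_sum => j _ /=.
  rewrite -[1 - t]ger0_norm ?subr_ge0// -[X in _ + X * _]ger0_norm ?(ltW t0)//.
  rewrite -!enormZ.
  apply: le_trans (ler_enormD _ _); rewrite le_eqVlt; apply/orP; left.
  apply/eqP; congr enorm; apply/rowP => m; rewrite !mxE; ring.
(* Optimality of [w] against [w + t *: (h - w)], multiplied by [N], bounds the loss increment below
   by [- b * lambda] times the penalty increment, which [Pconv] controls. *)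
have opt : - (b * lambda * (P (h \o p) - P x)) <=
    \sum_i dot (g i) (h (p i) - x i).
  apply: sum_gradient_ge => [i|t t0 t1]; first exact: f_diff.
  have /= := w_min (fun k => w k + t *: (h k - w k)).
  rewrite !(clustered_objectiveE _ _ _ Cp).
  have -> : w \o p = x by apply/funext => i; rewrite xE.
  have -> : (fun k => w k + t *: (h k - w k)) \o p =
      fun i => x i + t *: (h (p i) - x i).
    by apply/funext => i; rewrite xE.
  rewrite !full_objectiveE -/(P x) -/(P (fun i => x i + t *: (h (p i) - x i))).
  rewrite -(ler_pM2l b0) !(mulrDr b) !mulVKf ?gt_eqF// sumrB => wmin.
  have := ler_wpM2l (ltW (mulr_gt0 b0 lambda_gt0)) (Pconv t t0 t1); lra.
(* Cluster by cluster, this is the centered estimate for [r i = y i - h k] with [c = lambda]; [h k]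
   cancels in the pairwise differences. *)
have mean : - (lambda * Q) <= 2 * \sum_i dot (g i) (y i - h (p i)).
  rewrite /Q !(partition_big p xpredT)//=.
  rewrite [in leLHS]mulr_sumr [in leRHS]mulr_sumr -sumrN.
  apply: ler_sum => k _.
  have -> : \sum_(i | p i == k) \sum_(j | p j == p i) enorm (y i - y j) =
      \sum_(i in C k) \sum_(j in C k) enorm ((y i - h k) - (y j - h k)).
    rewrite Cp; apply: eq_big => i; first by rewrite inE.
    move=> /eqP ->; apply: eq_big => j; first by rewrite inE.
    by rewrite opprB addrA subrK.
  have -> : \sum_(i | p i == k) dot (g i) (y i - h (p i)) =
      \sum_(i in C k) dot (g i) (y i - h k).
    by rewrite Cp; apply: eq_big => i; [rewrite inE|move=> /eqP ->].
  apply: sum_dot_centered_ge => [|i j ik jk].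
    by rewrite sumrB hy sumr_const scaler_nat subrr.
  (* Divided by [#|C k|], the required gradient bound is one of the terms of the threshold. *)
  rewrite -ler_pdivrMr ?lt_neqAle ?[0 == _]eq_sym ?nC//=.
  apply: le_trans lambda_ge; rewrite /g (x_def k i ik) (x_def k j jk).
  apply: (bigmax_sup k) => //; apply: (bigmax_sup i) => //.
  exact: (bigmax_sup j).
have PQ : P (h \o p) + Q <= P y.
  apply: (@sum_enorm_fibers _ _ _ _ p) => k; rewrite -Cp -hy Cp.
  by apply: eq_bigl => i; rewrite inE.
have Q0 : 0 <= Q by do 2 apply: sumr_ge0 => ? _; exact: enorm_ge0.
(* Convexity at each [x i], with [y i - x i] split at the mean [h (p i)]. *)
have grad : \sum_i f i (x i) + \sum_i dot (g i) (y i - h (p i)) +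
    \sum_i dot (g i) (h (p i) - x i) <= \sum_i f i (y i).
  rewrite -!big_split; apply: ler_sum => i _ /=.
  rewrite -addrA -dotDr addrA subrK; exact: convex_gradient.
(* After multiplication by [b], the terms in [P (h \o p)] cancel between [opt] and [PQ]. What is
   left is [b * lambda * Q] against the loss [lambda * Q / 2] from [mean], and [b1] with [Q0]
   settles it. *)
rewrite !full_objectiveE -/b -/(P x) -/(P y).
rewrite -(ler_pM2l b0) !mulrDr !mulVKf ?gt_eqF//.
have := ler_wpM2l (ltW (mulr_gt0 b0 lambda_gt0)) PQ.
have := ler_wpM2r (mulr_ge0 (ltW lambda_gt0) Q0) b1.
have := mulr_ge0 (ltW lambda_gt0) Q0; lra.
Qed.
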